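(* Let $(\mathcal H_K,\langle\cdot,\cdot\rangle_K)$ be a vector-valued reproducing kernel Hilbert space of $\mathbb R^N$-valued functions defined on a set $\mathscr T$, with matrix-valued kernel $K$. Let $P\in\mathbb N$ and, for $i\in\{0,\dots,P\}$ and given $N_i\in\mathbb N$, let $\{t_{i,m}\}_{1\le m\le N_i}\subset\mathscr T$. Consider the following optimization problem with ''loss'' function $L:\mathbb R^{N_0}\to\mathbb R\cup\{+\infty\}$, strictly increasing ''regularizer'' function $\Omega:\mathbb R_+\to\mathbb R$, and constraints given by $d_i:\mathbb R^{N_i}\to\mathbb R$ and $\lambda_i\ge 0$ (for $i\in\{1,\dots,P\}$) and $\{\mathbf c_{i,m}\}_{1\le m\le N_i}\subset\mathbb R^N$ (for $i\in\{0,\dots,P\}$): $$\bar{\mathbf f}\in\operatorname*{arg\,min}_{\mathbf f\in\mathcal H_K}\; L\big(\mathbf c_{0,1}^\top\mathbf f(t_{0,1}),\dots,\mathbf c_{0,N_0}^\top\mathbf f(t_{0,N_0})\big)+\Omega(\|\mathbf f\|_K)$$ subject to $$\lambda_i\|\mathbf f\|_K\le d_i\big(\mathbf c_{i,1}^\top\mathbf f(t_{i,1}),\dots,\mathbf c_{i,N_i}^\top\mathbf f(t_{i,N_i})\big)\quad\text{for all } i\in\{1,\dots,P\}.$$ Then, for any minimizer $\bar{\mathbf f}$, there exist $\mathbf p_{i,m}\in\mathbb R^N$ ($0\le i\le P$, $1\le m\le N_i$) such that $$\bar{\mathbf f}=\sum_{i=0}^P\sum_{m=1}^{N_i}K(\cdot,t_{i,m})\,\mathbf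 p_{i,m},\qquad\text{with }\mathbf p_{i,m}=\alpha_{i,m}\mathbf c_{i,m}\text{ for some }\alpha_{i,m}\in\mathbb R.$$
   Context: A Hilbert space $(\mathcal H_K,\langle\cdot,\cdot\rangle_K)$ of $\mathbb R^N$-valued functions on a non-empty set $\mathscr T$ is called a vector-valued reproducing kernel Hilbert space (vRKHS) if there exists a matrix-valued kernel $K:\mathscr T\times\mathscr T\to\mathbb R^{N,N}$ such that for all $t\in\mathscr T$ and $\mathbf p\in\mathbb R^N$, $K(\cdot,t)\mathbf p\in\mathcal H_K$, and for all $\mathbf f\in\mathcal H_K$, $\mathbf p^\top\mathbf f(t)=\langle\mathbf f,K(\cdot,t)\mathbf p\rangle_K$ (here $\mathbb R^{N,N}$ is the space of real $N\times N$ matrices). $\|\cdot\|_K$ denotes the norm of $\mathcal H_K$, and $\mathbb R_+$ the set of nonnegative reals.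
   Formalization: A minimizer is required to have a finite objective value (the arg min is taken to be empty when the objective is +∞ on the whole feasible set); otherwise, with L identically +∞, every feasible f would be a minimizer and the claim would fail. *)

(* Defs.v *)
From HB Require Import structures.
From mathcomp Require Import all_boot all_order all_algebra sesquilinear.
From mathcomp Require Import all_classical all_reals all_analysis.

Set Implicit Arguments.
Unset Strict Implicit.
Unset Printing Implicit Defensive.

Import Order.TTheory GRing.Theory Num.Theory.
Import numFieldNormedType.Exports.

Local Open Scope ring_scope.

Definition ksection (R : realType) (T : Type) (N : nat)
    (K : T -> T -> 'M[R]_N) (t : T) (p : 'cV[R]_N) : T -> 'cV[R]_N :=
  fun s => K s t *m p.

Definition dotc (R : realType) (N : nat) (p x : 'cV[R]_N) : R :=
  (p^T *m x) 0 0.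

(* A Hilbert space of functions is encoded as an abstract real Hilbert space
   (a complete normed module whose norm comes from an inner product) together
   with an injective linear map [vrkhs_fun] sending each element to the
   function T -> R^N that it is; linearity says that the vector space
   operations are the pointwise ones. *)
Record vrkhs (R : realType) (T : Type) (N : nat) (K : T -> T -> 'M[R]_N) :=
  Vrkhs {
  vrkhs_space :> completeNormedModType R ;
  vrkhs_inner : {dot vrkhs_space for idfun} ;
  vrkhs_normE : forall f : vrkhs_space, `|f| = Num.sqrt (vrkhs_inner f f) ;
  vrkhs_fun : {linear vrkhs_space -> (T -> 'cV[R]_N)} ;
  vrkhs_fun_inj : injective vrkhs_fun ;
  vrkhs_reproducing : forall (t : T) (p : 'cV[R]_N),
    exists2 k : vrkhs_space, vrkhs_fun k = ksection K t p &
      forall f : vrkhs_space, dotc p (vrkhs_fun f t) = vrkhs_inner f k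
}.
Arguments vrkhs_inner {R T N K} v.
Arguments vrkhs_fun {R T N K} v.

Section Problem.
Variables (R : realType) (T : Type) (N : nat) (K : T -> T -> 'M[R]_N).
Variables (H : vrkhs K) (P : nat) (Ns : 'I_P.+1 -> nat).
Variables (t : forall i : 'I_P.+1, 'I_(Ns i) -> T).
Variables (c : forall i : 'I_P.+1, 'I_(Ns i) -> 'cV[R]_N).
Arguments t : clear implicits.
Arguments c : clear implicits.

Definition measurements (i : 'I_P.+1) (f : H) : 'cV[R]_(Ns i) :=
  \col_m dotc (c i m) (vrkhs_fun H f (t i m)).

Variables (L : 'cV[R]_(Ns ord0) -> \bar R) (Omega : R -> R).

(* The constraints are indexed by j : 'I_P, with [lift ord0 j] the index
   j + 1 in {1, .., P}. *)
Variables (d : forall j : 'I_P, 'cV[R]_(Ns (lift ord0 j)) -> R).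
Variables (lambda : 'I_P -> R).
Arguments d : clear implicits.

Definition feasible (f : H) : Prop :=
  forall j : 'I_P,
    lambda j * `|f| <= d j (measurements (lift ord0 j) f).

Definition objective (f : H) : \bar R :=
  (L (measurements ord0 f) + (Omega `|f|)%:E)%E.

(* As usual in extended-valued minimization, the arg min is empty when the
   objective is +oo on the whole feasible set; otherwise every feasible
   element would minimize. Hence the second conjunct. *)
Definition is_minimizer (f : H) : Prop :=
  [/\ feasible f, (objective f < +oo)%E &
      forall g : H, feasible g -> (objective f <= objective g)%E].

End Problem.

(* Main.v *)
Require Import Defs.
From HB Require Import structures.
From mathcomp Require Import all_boot all_order all_algebra sesquilinear.
From mathcomp Require Import all_classical all_reals all_analysis.

Set Implicit Arguments.
Unset Strict Implicit.
Unset Printing Implicit Defensive.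

Import Order.TTheory GRing.Theory Num.Theory.
Import numFieldNormedType.Exports.

Local Open Scope ring_scope.

(** The minimizer equals its orthogonal projection [g] onto the finite
    dimensional span of the representers [k i m], the elements of [H] such that
    the measurement [dotc (c i m) (f (t i m))] is the inner product of [f] with
    [k i m]. Such a projection exists by Gram-Schmidt
    ([exists_orthogonal_projection]). Orthogonality of [fbar - g] to the
    representers says that [g] and [fbar] have the same measurements. Unless
    [g = fbar], Pythagoras gives [`|g| < `|fbar|] ([pythagoras_lt]). Passing
    from [fbar] to [g] then leaves the right-hand sides of the constraints and
    the loss unchanged, does not increase the left-hand sides since
    [lambda j >= 0], and strictly decreases the regularizer, contradicting
    minimality: here it matters that the loss at [fbar] is a finite number,
    since adding [+oo] would hide the decrease. Finally the function
    associated with [k i m] is [ksection K (t i m) (c i m)], so an element of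
    the span is a function of the announced form. *)

Lemma dot_sumZr (R : realFieldType) (V : lmodType R) (form : {dot V for idfun})
    (I : finType) (u : V) (a : I -> R) (k : I -> V) :
  form u (\sum_i a i *: k i) = \sum_i a i * form u (k i).
Proof. by rewrite linear_sumr; apply: eq_bigr => i _; exact: linearZr_LR. Qed.

(** Coefficients are functions on all of [I], so that the induction on the
    list [s] of vectors projected on combines the projections of two vectors
    without reindexing, and [s] may contain repetitions. They vanish outside
    [s] because a residual orthogonal to the vectors indexed by [s] is only
    then orthogonal to the projections computed so far. *)
Lemma exists_orthogonal_projection (R : realFieldType) (V : lmodType R)
    (form : {dot V for idfun}) (I : finType) (k : I -> V) (s : seq I) (f : V) :
  exists2 a : I -> R, forall j, j \notin s -> a j = 0 &
    forall i, i \in s -> form (f - \sum_j a j *: k j) (k i) = 0.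
Proof.
elim: s f => [|x s IH] f; first by exists (fun=> 0).
have [a a0 aP] := IH f; have [b b0 bP] := IH (k x).
set u := f - _ in aP; set v := k x - _ in bP.
(* Gram-Schmidt step: [v] is the new direction, and the residual [u] loses its
   component along [v]; if [v = 0] then [r = 0], as division by 0 gives 0. *)
pose r := form u v / form v v.
exists (fun j => a j + r * ((j == x)%:R - b j)) => [j|].
  rewrite inE negb_or => /andP[/negPf-> sj].
  by rewrite a0 // b0 // subr0 mulr0 addr0.
have -> : f - \sum_j (a j + r * ((j == x)%:R - b j)) *: k j = u - r *: v.
  under eq_bigr do rewrite scalerDl -scalerA scalerBl.
  rewrite big_split /= -scaler_sumr sumrB.
  rewrite [X in _ + r *: (X - _)](_ : _ = k x); first by rewrite opprD addrA.
  rewrite (bigD1 x) //= eqxx scale1r big1 ?addr0 // => j /negPf ->.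
  by rewrite scale0r.
have orth_s i : i \in s -> form (u - r *: v) (k i) = 0.
  by move=> si; rewrite linearBl /= linearZl_LR /= aP // bP // mulr0 subr0.
(* Orthogonality to [k x] follows from orthogonality to [v], since
   [k x = v + \sum_j b j *: k j] and the sum only involves indices in [s]. *)
move=> i; rewrite inE => /predU1P[->|]; last exact: orth_s.
rewrite -[k x](subrK (\sum_j b j *: k j)) linearDr /= dot_sumZr.
rewrite [X in _ + X]big1 ?addr0 => [|j _].
  rewrite -/v linearBl /= linearZl_LR /=.
  have [->|v0] := eqVneq v 0; first by rewrite !linear0r subr0.
  by rewrite /r divfK ?subrr // gt_eqF // neq0_dnorm_gt0.
have [sj|/b0->] := boolP (j \in s); last by rewrite mul0r.
by rewrite orth_s // mulr0.
Qed.

Lemma dot_ge0 (R : realFieldType) (V : lmodType R) (form : {dot V for idfun})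
    (f : V) :
  0 <= form f f.
Proof.
by have [->|f0] := eqVneq f 0; rewrite ?linear0l // ltW ?neq0_dnorm_gt0.
Qed.

Lemma pythagoras_lt (R : realFieldType) (V : lmodType R)
    (form : {dot V for idfun}) (f g : V) :
  form (f - g) g = 0 -> f != g -> form g g < form f f.
Proof.
move=> fg0 fg; rewrite -[in ltRHS](subrK g f) hnormDd // ltrDr.
by rewrite neq0_dnorm_gt0 // subr_eq0.
Qed.

Lemma ksectionZ (R : realType) (T : Type) (N : nat) (K : T -> T -> 'M[R]_N)
    (t : T) (a : R) (p : 'cV[R]_N) :
  ksection K t (a *: p) = a *: ksection K t p.
Proof. by apply/funext => s; rewrite /ksection -scalemxAr. Qed.

Theorem theorem1 (R : realType) (T : Type) (T_nonempty : inhabited T) (N : nat)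
    (K : T -> T -> 'M[R]_N) (H : vrkhs K)
    (P : nat) (Ns : 'I_P.+1 -> nat)
    (t : forall i : 'I_P.+1, 'I_(Ns i) -> T)
    (c : forall i : 'I_P.+1, 'I_(Ns i) -> 'cV[R]_N)
    (L : 'cV[R]_(Ns ord0) -> \bar R)
    (L_neqNy : forall x : 'cV[R]_(Ns ord0), L x <> (-oo)%E)
    (Omega : R -> R)
    (Omega_incr : forall x y : R, 0 <= x -> x < y -> Omega x < Omega y)
    (d : forall j : 'I_P, 'cV[R]_(Ns (lift ord0 j)) -> R)
    (lambda : 'I_P -> R)
    (lambda_ge0 : forall j : 'I_P, 0 <= lambda j)
    (fbar : H)
    (fbar_min : is_minimizer t c L Omega d lambda fbar) :
  exists p : forall i : 'I_P.+1, 'I_(Ns i) -> 'cV[R]_N,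
    vrkhs_fun H fbar =
      \sum_(i < P.+1) \sum_(m < Ns i) ksection K (t i m) (p i m)
    /\ forall (i : 'I_P.+1) (m : 'I_(Ns i)),
         exists alpha : R, p i m = alpha *: c i m.
Proof.
have [k kE kP] : exists2 k : forall i, 'I_(Ns i) -> H,
    (forall i m, vrkhs_fun H (k i m) = ksection K (t i m) (c i m)) &
    forall i m f,
      dotc (c i m) (vrkhs_fun H f (t i m)) = vrkhs_inner H f (k i m).
  pose rep i m := cid2 (vrkhs_reproducing H (t i m) (c i m)).
  exists (fun i m => s2val (rep i m)) => i m; first exact: (s2valP (rep i m)).
  exact: (s2valP' (rep i m)).
pose kk (z : {i : 'I_P.+1 & 'I_(Ns i)}) := k (tag z) (tagged z).
have [a _ aP] :=
  exists_orthogonal_projection (vrkhs_inner H) kk (enum {: _}) fbar.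
set g := \sum_j a j *: kk j in aP.
have orth i m : vrkhs_inner H (fbar - g) (k i m) = 0.
  by apply: (aP (Tagged (fun i => 'I_(Ns i)) m)); rewrite mem_enum.
have meas i : measurements t c i g = measurements t c i fbar.
  apply/colP => m; rewrite !mxE !kP; apply/eqP; rewrite eq_sym -subr_eq0.
  by rewrite -linearBl /= orth.
have gfbar : fbar = g.
  apply/eqP/negP => /negP fg.
  have norm_lt : `|g| < `|fbar|.
    have g0 : vrkhs_inner H (fbar - g) g = 0.
      by rewrite dot_sumZr big1 // => -[i m] _; rewrite orth mulr0.
    have := pythagoras_lt g0 fg.
    by move=> lt_gf; rewrite !vrkhs_normE ltr_sqrt // (le_lt_trans _ lt_gf) // dot_ge0.
  have [feas fin min] := fbar_min.
  have /min : feasible t c d lambda g.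
    move=> j; rewrite meas; apply: le_trans (feas j).
    by rewrite ler_wpM2l // ltW.
  apply/negP; rewrite -ltNge; move: fin; rewrite /objective meas.
  case: (L _) (L_neqNy (measurements t c ord0 fbar)) => //= l _ _.
  by rewrite !lte_fin ltrD2l Omega_incr.
exists (fun i m => a (Tagged _ m) *: c i m); split; last by move=> i m; eexists.
rewrite [LHS](congr1 _ gfbar) /g linear_sum sig_big_dep /=.
by apply: eq_bigr => -[i m] _; rewrite linearZ /= kE ksectionZ.
Qed.
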